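(* Suppose $\nu_i:\mathcal O(X)\to\mathcal B(\mathcal H_i)$, $i=1,2$, are POVMs such that $\nu_1\ll_{\rm ac}\nu_2$. If $\nu_i=(\nu_i)_a+(\nu_i)_{na}$ is the unique decomposition of $\nu_i$ into its atomic part $(\nu_i)_a$ and non-atomic part $(\nu_i)_{na}$ ($i=1,2$), then $(\nu_1)_a\ll_{\rm ac}(\nu_2)_a$ and $(\nu_1)_{na}\ll_{\rm ac}(\nu_2)_{na}$.
   Context: $X$ is a locally compact Hausdorff space with Borel $\sigma$-algebra $\mathcal O(X)$; $\mathcal H_1,\mathcal H_2$ are separable Hilbert spaces. A POVM $\nu:\mathcal O(X)\to\mathcal B(\mathcal H)$ is a map with positive operator values that is countably additive on pairwise disjoint countable families, with convergence in the ultraweak topology. $\vartheta_2\ll_{\rm ac}\vartheta_1$ means $\vartheta_2(E)=0$ whenever $E\in\mathcal O(X)$ and $\vartheta_1(E)=0$. An atom of $\nu$ is a set $A\in\mathcal O(X)$ with $\nu(A)\neq 0$ such that every measurable $B\subseteq A$ satisfies $\nu(B)=0$ or $\nu(B)=\nu(A)$. $\nu$ is atomic if every measurable set $E$ with $\nu(E)\ne 0$ contains an atom, and non-atomic if it has no atoms. Every POVM (on a separable Hilbert space) is uniquely the sum of an atomic POVM and a non-atomic POVM. *)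

(* Defs.v *)
From HB Require Import structures.
From mathcomp Require Import all_boot all_order all_algebra.
From mathcomp Require Import complex.
From mathcomp Require Import all_classical all_reals all_analysis.
Set Implicit Arguments.
Unset Strict Implicit.
Unset Printing Implicit Defensive.
Import Order.TTheory GRing.Theory Num.Theory.
Import numFieldNormedType.Exports.
Local Open Scope classical_set_scope.
Local Open Scope ring_scope.

(* [C] is kept abstract only so that the topology of a [numFieldType] is      *)
(* inferred on the scalars; a Hilbert space is a [hilbertType R[i]] with      *)
(* [R : realType]. The inner product is linear in its first argument.         *)
(* Definiteness follows from [dotp_norm], as [`|_|] is a norm.                *)
HB.mixin Record CompleteNormedModule_isHilbert (C : numClosedFieldType) H
    & CompleteNormedModule C H := {
  dotp : H -> H -> C ;
  dotp_linearl : forall (a : C) (x y z : H),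
    dotp (a *: x + y) z = a * dotp x z + dotp y z ;
  dotp_conj : forall x y : H, dotp y x = (dotp x y)^* ;
  dotp_norm : forall x : H, dotp x x = `|x| ^+ 2
}.

#[short(type="hilbertType")]
HB.structure Definition Hilbert (C : numClosedFieldType) :=
  {H of CompleteNormedModule C H & CompleteNormedModule_isHilbert C H}.

Definition separable (T : topologicalType) :=
  exists2 D : set T, countable D & dense D.

Definition borel (X : topologicalType) : set (set X) := <<s @open X >>.

Section Operators.
Context (C : numClosedFieldType) (H : hilbertType C).
Implicit Types (T L : H -> H) (x y : nat -> H).

Definition bounded_op T :=
  linear T /\ exists M : C, forall u : H, `|T u| <= M * `|u|.

(* [0 <= z] in [C] means that [z] is real and nonnegative *)
Definition positive_op T := forall u : H, 0 <= dotp (T u) u.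

Definition square_summable x := cvgn (series (fun k => `|x k| ^+ 2 : C)).

(* The ultraweak topology on bounded operators is the initial topology for    *)
(* the functionals [T |-> \sum_k <T x_k, y_k>] with [x] and [y] square        *)
(* summable; these series converge absolutely when [C] is [R[i]].             *)
Definition ultraweak_functional x y T : C :=
  limn (series (fun k => dotp (T (x k)) (y k))).

Definition ultraweak_cvg (S : nat -> H -> H) L :=
  forall x y, square_summable x -> square_summable y ->
    ultraweak_functional x y (S n) @[n --> \oo]
      --> ultraweak_functional x y L.

End Operators.

(* A POVM is a function on all subsets of [X], whose values outside           *)
(* [borel X] are irrelevant. Operators are compared as functions [H -> H].    *)
(* No normalisation [nu setT = id] is required. [nu set0 = 0] follows from    *)
(* additivity on the constant sequence [set0], so additivity on finite        *)
(* disjoint families is included.                                             *)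
Section POVM.
Context (X : topologicalType) (C : numClosedFieldType) (H : hilbertType C).
Implicit Types nu : set X -> H -> H.

Definition povm nu :=
  [/\ forall E, borel E -> bounded_op (nu E),
      forall E, borel E -> positive_op (nu E) &
      forall E : nat -> set X, (forall k, borel (E k)) -> trivIset setT E ->
        ultraweak_cvg (fun n => \sum_(k < n) nu (E k)) (nu (\bigcup_k E k))].

Definition atom nu (A : set X) :=
  [/\ borel A, nu A <> 0 &
      forall B, borel B -> B `<=` A -> nu B = 0 \/ nu B = nu A].

Definition atomic nu :=
  forall E, borel E -> nu E <> 0 -> exists2 A, atom nu A & A `<=` E.

Definition non_atomic nu := forall A, ~ atom nu A.

Definition atomic_decomposition nu nu_a nu_na :=
  [/\ povm nu_a /\ atomic nu_a, povm nu_na /\ non_atomic nu_na &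
      forall E, borel E -> nu E = nu_a E + nu_na E].

End POVM.

Definition abs_cont (X : topologicalType) (C : numClosedFieldType)
    (H1 H2 : hilbertType C) (nu1 : set X -> H1 -> H1) (nu2 : set X -> H2 -> H2) :=
  forall E, borel E -> nu2 E = 0 -> nu1 E = 0.

Notation "nu1 '<<ac' nu2" := (abs_cont nu1 nu2) (at level 70).

(* Main.v *)
Require Import Defs.
From HB Require Import structures.
From mathcomp Require Import all_boot all_order all_algebra.
From mathcomp Require Import complex.
From mathcomp Require Import all_classical all_reals all_analysis.
From mathcomp Require Import ring.
Set Implicit Arguments.
Unset Strict Implicit.
Unset Printing Implicit Defensive.
Import Order.TTheory GRing.Theory Num.Theory.
Import numFieldNormedType.Exports.
Local Open Scope classical_set_scope.
Local Open Scope ring_scope.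

(** Write N(nu) for the Borel sets on which a POVM nu vanishes. Everything
    happens at the level of these null sets. Positivity makes N(nu) hereditary,
    countable additivity makes it closed under countable unions, and since the
    two parts of a decomposition are positive, N(nu) is the intersection of
    N(nu_a) and N(nu_na).

    Separability enters through [povm_exhaustion]: a family of Borel sets closed
    under countable unions has a member that contains all the others up to
    nu-null sets. It replaces the usual passage to a scalar measure: for h in a
    dense sequence, some member maximises the bounded monotone set function
    A |-> <nu(A) h, h>, and the union of these maximisers works for every h at
    once, hence for the operator nu itself.

    Applied to the mu-null subsets of an atom A of a POVM mu, this shows
    ([atom_trim]) that A can be shrunk, without losing mu-mass, to a set that is
    null for any prescribed non-atomic POVM nu: on what remains of A after
    removing the mu-null set that is maximal for nu, one half of every splitting
    is mu-null and hence nu-null, so what remains would be an atom of nu if it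
    were not nu-null.

    The theorem follows. If nu2a(E) = 0 but nu1a(E) is nonzero, an atom of nu1a
    inside E, trimmed against nu2na, is null for nu2 but not for nu1. If
    nu2na(E) = 0, exhaust nu2a by nu1na-null subsets of E: what is left of E is
    nu2a-null, as otherwise it would contain an atom of nu2a, and trimming this
    atom against nu1na would give a further nu1na-null piece. So what is left is
    nu2-null, hence nu1-null. *)

(** * Positive operators on a Hilbert space *)

Section HilbertOperators.
Context (C : numClosedFieldType) (H : hilbertType C).
Implicit Types (T : H -> H) (u v : H).

Lemma dotpDl (x y z : H) : dotp (x + y) z = dotp x z + dotp y z.
Proof. by rewrite -[x]scale1r dotp_linearl mul1r scale1r. Qed.

Lemma dotp0l (z : H) : dotp 0 z = 0.
Proof.
by apply: (@addrI _ (dotp 0 z)); rewrite -dotpDl !addr0.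
Qed.

Lemma dotpZl (a : C) (x z : H) : dotp (a *: x) z = a * dotp x z.
Proof. by rewrite -[a *: x]addr0 dotp_linearl dotp0l addr0. Qed.

Lemma dotpDr (x y z : H) : dotp x (y + z) = dotp x y + dotp x z.
Proof. by rewrite dotp_conj dotpDl rmorphD /= -!dotp_conj. Qed.

Lemma dotpZr (a : C) (x z : H) : dotp x (a *: z) = a^* * dotp x z.
Proof. by rewrite dotp_conj dotpZl rmorphM /= -dotp_conj. Qed.

Lemma dotp0r (z : H) : dotp z 0 = 0.
Proof. by rewrite dotp_conj dotp0l conjC0. Qed.

Lemma dotp_ext u v : (forall z : H, dotp u z = dotp v z) -> u = v.
Proof.
move=> uv; apply/eqP; rewrite -subr_eq0 -normr_eq0 -sqrf_eq0 -dotp_norm.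
by rewrite dotpDl uv -dotpDl subrr dotp0l.
Qed.

Lemma bounded_opD T u v : bounded_op T -> T (u + v) = T u + T v.
Proof. by move=> [linT _]; rewrite -[u]scale1r linT !scale1r. Qed.

Lemma bounded_op0 T : bounded_op T -> T 0 = 0.
Proof.
by move=> bT; apply: (@addrI _ (T 0)); rewrite -bounded_opD// !addr0.
Qed.

Lemma bounded_opZ T (a : C) u : bounded_op T -> T (a *: u) = a *: T u.
Proof.
by move=> bT; rewrite -[a *: u]addr0 (proj1 bT) bounded_op0// addr0.
Qed.

(** The polynomial attains its minimum at t = 0, where its derivative is c.
    Since 0 <= z in C also says that z is real, the value at t = 1 shows that c
    is real. *)
Lemma real_quadratic_ge0_coef_eq0 (c r : C) : 0 <= r ->
  (forall t : C, t \is Num.real -> 0 <= t * c + t ^+ 2 * r) -> c = 0.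
Proof.
move=> r0 pos; have cR : c \is Num.real.
  rewrite -[c](addrK r) rpredB// ?ger0_real//.
  by have := pos 1 (rpred1 _); rewrite mul1r expr1n mul1r.
have r1 : 0 < r + 1 by rewrite ltr_wpDl.
have tR : - (c / (r + 1)) \is Num.real.
  by rewrite rpredN rpredM// rpredV gtr0_real.
apply/eqP; rewrite -sqrf_eq0 eq_le -realEsqr cR andbT.
(* at t = - c / (r + 1) the form is - c ^+ 2 / (r + 1) ^+ 2 *)
have := pos _ tR.
have -> : - (c / (r + 1)) * c + (- (c / (r + 1))) ^+ 2 * r
   = - (c ^+ 2 / (r + 1) ^+ 2).
  have r10 : r + 1 != 0 by rewrite gt_eqF.
  rewrite sqrrN expr_div_n mulNr mulrAC -expr2 [X in - X + _ * _](_ : _ =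
    c ^+ 2 / (r + 1) ^+ 2 * (r + 1)); last first.
    by rewrite expr2 [(r + 1) ^+ 2]expr2 invfM -!mulrA mulVf// mulr1.
  by rewrite mulrDr mulr1 opprD addrAC addNr add0r.
by rewrite oppr_ge0 pmulr_lle0// invr_gt0 exprn_gt0.
Qed.

(** The degenerate case of the Cauchy-Schwarz inequality for the form
    <T u, v>. Expand <T w, w> >= 0 at w = u + a *: T u: real values of a kill
    the sum p + q of the two cross terms p = <T u, T u> and q = <T (T u), u>,
    imaginary values kill their difference, and p is the squared norm of T u.
    The imaginary values stand in for the self-adjointness of T. *)
Lemma positive_op_form_eq0 T u : bounded_op T -> positive_op T ->
  dotp (T u) u = 0 -> T u = 0.
Proof.
move=> bT pT Tu0.
set v := T u; set p := dotp (T u) v; set q := dotp (T v) u.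
set r := dotp (T v) v.
have r0 : 0 <= r by exact: pT.
have form a : 0 <= a^* * p + a * q + a * a^* * r.
  have := pT (u + a *: v).
  rewrite bounded_opD// bounded_opZ// !dotpDl !dotpDr !dotpZl !dotpZr Tu0.
  by rewrite add0r addrA mulrA.
have pq : p + q = 0.
  apply: (real_quadratic_ge0_coef_eq0 r0) => t tR.
  by have := form t; rewrite (CrealP tR) -expr2 -mulrDr.
have pq' : 'i * (q - p) = 0.
  apply: (real_quadratic_ge0_coef_eq0 r0) => t tR.
  have := form ('i * t); rewrite rmorphM /= conjCi (CrealP tR).
  suff -> : t * ('i * (q - p)) + t ^+ 2 * r = - 'i * t * p + 'i * t * q +
    'i * t * (- 'i * t) * r + t ^+ 2 * r * ('i ^+ 2 + 1).
    by rewrite sqrCi addNr mulr0 addr0.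
  by ring.
have {}pq' : q = p.
  by move/eqP: pq'; rewrite mulf_eq0 (negPf (neq0Ci _)) subr_eq0 => /eqP.
move/eqP: pq; rewrite pq' -mulr2n mulrn_eq0 /= /p /v dotp_norm sqrf_eq0.
by rewrite normr_eq0 => /eqP.
Qed.

(** Passing first from <T h, h> = 0 to T h = 0 leaves only the continuity of the
    bounded operator T to be used. *)
Lemma positive_op_dense_eq0 T (D : set H) :
  bounded_op T -> positive_op T -> dense D ->
  (forall h, D h -> dotp (T h) h = 0) -> T = 0.
Proof.
move=> bT pT dD TD; apply/funext => u; apply/eqP; rewrite -normr_eq0.
apply: contraT => Tu0.
have [_ [M leM]] := bT.
have M1 : 0 < `|M| + 1 by rewrite ltr_wpDl.
have e0 : 0 < `|T u| / (`|M| + 1) by rewrite divr_gt0// lt_def Tu0/=.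
have [|h [uh Dh]] := dD (ball u (`|T u| / (`|M| + 1))) _ (ball_open _ _).
  by exists u; exact: ballxx.
have Th : T h = 0 by apply: positive_op_form_eq0 => //; exact: TD.
(* the radius is chosen so that |T u| <= |M| |u - h| becomes absurd *)
have Tuh : T u = T (u - h).
  by rewrite -[in LHS](subrK h u) (bounded_opD (u - h) h bT) Th addr0.
have : `|T u| <= `|M| * (`|T u| / (`|M| + 1)).
  have lM := leM (u - h).
  rewrite Tuh (le_trans lM)// -Tuh.
  rewrite -[M * _]ger0_norm ?(le_trans _ lM)// normrM normr_id.
  by rewrite ler_wpM2l//; move: uh; rewrite -ball_normE => /ltW.
rewrite mulrCA ler_pMr ?lt_def ?Tu0//=.
by rewrite ler_pdivlMr// mul1r gerDl ler10.
Qed.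

Lemma positive_op_add_eq0 (S T : H -> H) :
  bounded_op S -> positive_op S -> positive_op T -> S + T = 0 -> S = 0.
Proof.
move=> bS pS pT ST0; apply/funext => u; apply: positive_op_form_eq0 => //.
apply/eqP; rewrite eq_le pS andbT.
have : dotp ((S + T) u) u = 0 by rewrite ST0 dotp0l.
by rewrite dotpDl => /eqP; rewrite addr_eq0 => /eqP ->; rewrite oppr_le0.
Qed.

End HilbertOperators.

(** * Borel sets *)

Section BorelSets.
Context (X : topologicalType).
Implicit Types A B : set X.

Lemma borel_bigcup (F : nat -> set X) :
  (forall k, borel (F k)) -> borel (\bigcup_k F k).
Proof. exact: sigma_algebra_bigcup. Qed.

Lemma borel0 : borel (set0 : set X).
Proof. exact: sigma_algebra0. Qed.

Lemma borelU A B : borel A -> borel B -> borel (A `|` B).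
Proof.
by move=> bA bB; rewrite -bigcup2E; apply: borel_bigcup => -[|[|k]]//=;
  exact: borel0.
Qed.

Lemma borelC A : borel A -> borel (~` A).
Proof. by rewrite -setTD; exact: sigma_algebraCD. Qed.

Lemma borelD A B : borel A -> borel B -> borel (A `\` B).
Proof.
move=> bA bB; rewrite setDE -[A `&` _]setCK setCI setCK.
by apply: borelC; apply: borelU => //; exact: borelC.
Qed.

Lemma borel_seqDU (F : nat -> set X) k :
  (forall k, borel (F k)) -> borel (seqDU F k).
Proof.
move=> bF; apply: borelD => //.
by apply: big_ind => //; [exact: borel0|exact: borelU].
Qed.

End BorelSets.

(** * From ultraweak to weak convergence *)

Section UltraweakDelta.
Context (C : numClosedFieldType) (H : hilbertType C).

(** On sequences supported at index 0 the ultraweak functionals reduce to the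
    matrix coefficients <T u, v>. *)
Definition delta_seq (u : H) (k : nat) : H := if k == 0%N then u else 0.

Lemma series_near_head (f : nat -> C) : (forall k, f k.+1 = 0) ->
  \forall n \near \oo, series f n = f 0%N.
Proof.
move=> f0; near=> n.
have n0 : (0 < n)%N by near: n; exact: nbhs_infty_gt.
rewrite /series/= big_ltn// big_nat big1 ?addr0// => -[//|k] _; exact: f0.
Unshelve. all: by end_near. Qed.

Lemma square_summable_delta (u : H) : square_summable (delta_seq u).
Proof.
apply/cvg_ex; exists (`|u| ^+ 2); apply: cvg_near_cst.
apply: (series_near_head (f := fun k => `|delta_seq u k| ^+ 2)) => k.
by rewrite /delta_seq/= normr0 expr0n.
Qed.

Lemma ultraweak_functional_delta (u v : H) (T : H -> H) :
  ultraweak_functional (delta_seq u) (delta_seq v) T = dotp (T u) v.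
Proof.
apply: lim_near_cst; first exact: norm_hausdorff.
apply: (series_near_head
  (f := fun k => dotp (T (delta_seq u k)) (delta_seq v k))) => k.
by rewrite /delta_seq/= dotp0r.
Qed.

Lemma ultraweak_cvg_form (S : nat -> H -> H) (L : H -> H) (u v : H) :
  ultraweak_cvg S L -> dotp (S n u) v @[n --> \oo] --> dotp (L u) v.
Proof.
move=> cv.
have := cv _ _ (@square_summable_delta u) (@square_summable_delta v).
rewrite ultraweak_functional_delta.
by under eq_fun do rewrite ultraweak_functional_delta.
Qed.

Lemma ultraweak_cvg_near_cst (S : nat -> H -> H) (L T : H -> H) :
  ultraweak_cvg S L -> (\forall n \near \oo, S n = T) -> L = T.
Proof.
move=> SL ST; apply/funext => u; apply: dotp_ext => z.
apply: (cvg_unique _ (ultraweak_cvg_form (u := u) (v := z) SL)).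
  exact: norm_hausdorff.
by apply: cvg_near_cst; apply: filterS ST => n ->.
Qed.

End UltraweakDelta.

(** * Null sets of a POVM *)

Section POVMTheory.
Context (X : topologicalType) (C : numClosedFieldType) (H : hilbertType C).
Implicit Types (nu : set X -> H -> H) (A B : set X).

(** On the constant sequence set0 the partial sums of matrix coefficients are
    n * c with c = <nu(set0) u, z>; they converge, so their increment c is 0. *)
Lemma povm_set0 nu : povm nu -> nu set0 = 0.
Proof.
move=> [_ _ /(_ (fun=> set0) (fun=> @borel0 X))].
have triv0 : trivIset setT (fun _ : nat => set0 : set X).
  by apply/trivIsetP => i j _ _ _; rewrite set0I.
rewrite bigcup0// => /(_ triv0) cv.
apply/funext => u; apply: dotp_ext => z; rewrite dotp0l.
set c := dotp _ z.
have ccv := ultraweak_cvg_form (u := u) (v := z) cv.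
have ccv' := ccv; rewrite -cvg_shiftS in ccv'.
have {ccv ccv'} := cvgB ccv' ccv => /(_ eventually_filter).
rewrite subrr => cv0.
apply/esym; apply: (cvg_unique _ cv0); first exact: norm_hausdorff.
apply: cvg_near_cst; near=> n.
rewrite -[LHS]/(dotp ((\sum_(k < n.+1) nu set0) u) z -
  dotp ((\sum_(k < n) nu set0) u) z).
by rewrite big_ord_recr /= dotpDl addrAC subrr add0r.
Unshelve. all: by end_near. Qed.

Lemma povmU nu A B : povm nu -> borel A -> borel B -> A `&` B = set0 ->
  nu (A `|` B) = nu A + nu B.
Proof.
move=> pnu bA bB AB0; have [_ _ sigma_add] := pnu.
have bAB k : borel (bigcup2 A B k).
  by case: k => [|[|k]] //=; exact: borel0.
have := sigma_add _ bAB; rewrite -trivIset_bigcup2 bigcup2E => /(_ AB0) cv.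
apply: (ultraweak_cvg_near_cst cv); exists 2%N => // -[|[|n]]// _.
by rewrite 2!big_ord_recl/= big1 ?addr0// => k _; rewrite povm_set0.
Qed.

Lemma povmD nu A B : povm nu -> borel A -> borel B -> A `<=` B ->
  nu B = nu A + nu (B `\` A).
Proof.
move=> pnu bA bB AB; rewrite -povmU//; first by rewrite setDUK.
  exact: borelD.
by rewrite setDIK.
Qed.

Lemma povm_null_sub nu A B : povm nu -> borel A -> borel B -> A `<=` B ->
  nu B = 0 -> nu A = 0.
Proof.
move=> pnu bA bB AB; rewrite (povmD pnu bA bB AB).
by have [bnd pos _] := pnu; apply: positive_op_add_eq0;
  [exact: bnd|exact: pos|apply: pos; exact: borelD].
Qed.

(** A union of null sets is a disjoint union of null sets, whose partial sums
    are constantly 0. *)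
Lemma povm_null_bigcup nu (F : nat -> set X) : povm nu ->
  (forall k, borel (F k)) -> (forall k, nu (F k) = 0) ->
  nu (\bigcup_k F k) = 0.
Proof.
move=> pnu bF F0; have [_ _ sigma_add] := pnu.
have bD k : borel (seqDU F k) by exact: borel_seqDU.
have := sigma_add _ bD (@trivIset_seqDU _ F); rewrite -seqDU_bigcup_eq => cv.
apply: (ultraweak_cvg_near_cst cv); apply: nearW => n.
rewrite big1// => k _; apply: (povm_null_sub (B := F k)) => //.
exact: subDsetl.
Qed.

Lemma atomic_decomposition_eq0 nu nu_a nu_na E :
  atomic_decomposition nu nu_a nu_na -> borel E ->
  (nu E = 0) <-> (nu_a E = 0 /\ nu_na E = 0).
Proof.
move=> [[pa _] [pna _] dec] bE; rewrite dec//.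
have [ba posa _] := pa; have [bna posna _] := pna.
split=> [E0|[-> ->]]; last by rewrite addr0.
split; first exact: (positive_op_add_eq0 (ba _ bE) (posa _ bE) (posna _ bE)).
rewrite addrC in E0.
exact: (positive_op_add_eq0 (bna _ bE) (posna _ bE) (posa _ bE)).
Qed.

End POVMTheory.

(** * Exhaustion *)

Definition bigcup_closed (T : Type) (P : set (set T)) :=
  forall F : nat -> set T, (forall k, P (F k)) -> P (\bigcup_k F k).

(** The supremum is attained on the union of a maximising sequence. *)
Lemma bigcup_closed_max (R : realType) (T : Type) (P : set (set T))
    (f : set T -> R) (M : R) (A0 : set T) :
  bigcup_closed P -> P A0 ->
  (forall A B, P A -> P B -> A `<=` B -> f A <= f B) ->
  (forall A, P A -> f A <= M) ->
  exists2 B, P B & forall A, P A -> f A <= f B.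
Proof.
move=> Pcup PA0 fmono fM.
have supf : has_sup (f @` P).
  split; first by exists (f A0); exists A0.
  by exists M => _ [A PA <-]; exact: fM.
have approx (k : nat) : exists A, P A /\ sup (f @` P) - k.+1%:R^-1 < f A.
  have [|_ [A PA <-] fA] := sup_adherent (eps := k.+1%:R^-1) _ supf.
    by rewrite invr_gt0 ltr0n.
  by exists A.
have [F PF] := choice approx.
exists (\bigcup_k F k) => [|A PA]; first by apply: Pcup => k; case: (PF k).
apply: (@le_trans _ _ (sup (f @` P))).
  by apply: (ub_le_sup (proj2 supf)); exists A.
apply/ler_addgt0Pr => e e0.
have [k ke] : exists k : nat, k.+1%:R^-1 < e.
  by have [k _ /(_ _ (leqnn k))] := near_infty_natSinv_lt (PosNum e0); exists k.
have [PFk supFk] := PF k.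
rewrite -lerBlDr; apply: (@le_trans _ _ (f (F k))).
  by apply/ltW/(le_lt_trans _ supFk); rewrite lerB// ltW.
by apply: fmono => //; [apply: Pcup => j; case: (PF j)|exact: bigcup_sup].
Qed.

Section Exhaustion.
Context (R : realType) (X : topologicalType) (H : hilbertType R[i]).
Context (nu : set X -> H -> H) (pnu : povm nu).

Definition quadratic_form (h : H) (A : set X) : R :=
  complex.Re (dotp (nu A h) h).

Lemma quadratic_formD h A B : borel A -> borel B -> A `<=` B ->
  quadratic_form h B = quadratic_form h A + quadratic_form h (B `\` A).
Proof.
by move=> bA bB AB; rewrite /quadratic_form (povmD pnu bA bB AB) dotpDl raddfD.
Qed.

Lemma quadratic_form_ge0 h A : borel A -> 0 <= quadratic_form h A.
Proof.
move=> bA; have [_ pos _] := pnu.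
by have := pos A bA h; rewrite lecE => /andP[].
Qed.

Lemma quadratic_form_le h A B : borel A -> borel B -> A `<=` B ->
  quadratic_form h A <= quadratic_form h B.
Proof.
move=> bA bB AB; rewrite (quadratic_formD h bA bB AB) lerDl.
by apply: quadratic_form_ge0; exact: borelD.
Qed.

Lemma quadratic_form_eq0 h A : borel A -> quadratic_form h A = 0 ->
  dotp (nu A h) h = 0.
Proof.
move=> bA A0; have [_ pos _] := pnu.
have := pos A bA h; rewrite lecE => /andP[/eqP im _].
by apply/eqP; rewrite eq_complex; apply/andP; split; apply/eqP.
Qed.

(** For each point of a dense sequence [bigcup_closed_max] gives a maximiser of
    the quadratic form at that point, and enlarging a maximiser keeps it one, so
    the union B of all of them is a maximiser for every point. Then nu(A `\` B)
    has quadratic form 0 at a dense set of points. *)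
Lemma povm_exhaustion (P : set (set X)) (A0 : set X) : separable H ->
  P `<=` @borel X -> bigcup_closed P -> P A0 ->
  exists2 B, P B & forall A, P A -> nu (A `\` B) = 0.
Proof.
move=> [D Dcount Ddense] Pborel Pcup PA0.
have [D0|[d]] := pfcard_geP Dcount.
  by have [|x [_]] := Ddense setT _ openT; [exists 0|rewrite D0].
have bT : borel (setT : set X) by rewrite -setC0; exact: (borelC (@borel0 X)).
have maxk (k : nat) :
    exists B, P B /\
      forall A, P A -> quadratic_form (d k) A <= quadratic_form (d k) B.
  have [|A PA|B PB Bmax] := bigcup_closed_max (f := quadratic_form (d k))
    (M := quadratic_form (d k) setT) Pcup PA0; last by exists B.
  - by move=> A B PA PB; apply: quadratic_form_le; exact: Pborel.
  - by apply: quadratic_form_le => //; exact: Pborel.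
have [F PF] := choice maxk.
have PcupF : P (\bigcup_k F k) by apply: Pcup => k; case: (PF k).
exists (\bigcup_k F k) => // A PA; set B := \bigcup_k F k in PcupF *.
have bA := Pborel _ PA; have bB := Pborel _ PcupF.
have bAB := borelD bA bB; have [bnd pos _] := pnu.
have PU : P (B `|` A).
  have -> : B `|` A = \bigcup_k (if k == 0%N then B else A).
    rewrite predeqE => x; split=> [[Bx|Ax]|[[|k] _ ?]].
    - by exists 0%N.
    - by exists 1%N.
    - by left.
    - by right.
  by apply: Pcup => -[|k].
apply: (positive_op_dense_eq0 (bnd _ bAB) (pos _ bAB) Ddense) => h Dh.
have [k _ <-] : (d @` setT) h by apply: surj.
apply: quadratic_form_eq0 => //; apply/eqP.
rewrite eq_le quadratic_form_ge0// andbT.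
have [PFk Fmax] := PF k.
have : quadratic_form (d k) (B `|` A) <= quadratic_form (d k) B.
  apply: (le_trans (Fmax _ PU)); apply: quadratic_form_le => //.
    exact: Pborel.
  exact: bigcup_sup.
rewrite (quadratic_formD _ bB (Pborel _ PU)); last exact: subsetUl.
by rewrite gerDl setDUl setDv set0U.
Qed.

End Exhaustion.

(** * Atoms against non-atomic POVMs *)

Lemma bigcup_closed_null (X : topologicalType) (C : numClosedFieldType)
    (H : hilbertType C) (nu : set X -> H -> H) (E : set X) : povm nu ->
  bigcup_closed [set B | [/\ borel B, B `<=` E & nu B = 0]].
Proof.
move=> pnu F PF; split.
- by apply: borel_bigcup => k; have [] := PF k.
- by apply: bigcup_sub => k _; have [] := PF k.
- by apply: povm_null_bigcup => // k; have [] := PF k.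
Qed.

(** Let D be a mu-null part of A that is maximal for nu, and B = A `\` D. A
    subset of B that is mu-null is nu-null, by maximality. For G inside B, one
    of G and B `\` G is mu-null, as A is an atom of mu; so nu(G) is 0 or nu(B),
    and nu(B) = 0 because nu has no atom. *)
Lemma atom_trim (R : realType) (X : topologicalType) (H K : hilbertType R[i])
    (mu : set X -> H -> H) (nu : set X -> K -> K) (A : set X) :
  separable K -> povm mu -> povm nu -> atom mu A -> non_atomic nu ->
  exists B, [/\ borel B, B `<=` A, mu B <> 0 & nu B = 0].
Proof.
move=> sepK pmu pnu [bA A0 atomA] nonatomic.
have [||D [bD DA D0] Dmax] := povm_exhaustion pnu (A0 := set0) sepK _
    (bigcup_closed_null (E := A) pmu); first by move=> B [].
  by split; [exact: borel0|exact: sub0set|exact: povm_set0].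
have bB := borelD bA bD; have BA : A `\` D `<=` A by exact: subDsetl.
have muB : mu (A `\` D) = mu A by rewrite (povmD pmu bD bA DA) D0 add0r.
exists (A `\` D); split => //; first by rewrite muB.
apply: contrapT => nuB0; apply: (nonatomic (A `\` D)); split => // G bG GB.
have null_away G' : borel G' -> G' `<=` A `\` D -> mu G' = 0 -> nu G' = 0.
  move=> bG' G'B G'0; rewrite -(Dmax G').
    by congr nu; apply/esym/setDidl/disjoints_subset => x /G'B[].
  by split=> //; exact: (subset_trans G'B).
have bBG := borelD bB bG.
have [muG|muG] := atomA _ bG (subset_trans GB BA).
  by left; exact: null_away.
have muBG : mu ((A `\` D) `\` G) = 0.
  by apply: (@addrI _ (mu G)); rewrite -(povmD pmu bG bB GB) muB muG addr0.
right; rewrite (povmD pnu bG bB GB) (null_away _ bBG) ?addr0//.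
Qed.

Theorem corollary3p13 (R : realType) (X : topologicalType)
    (lcX : locally_compact [set: X]) (hausX : hausdorff_space X)
    (H1 H2 : hilbertType R[i]) (sep1 : separable H1) (sep2 : separable H2)
    (nu1 nu1a nu1na : set X -> H1 -> H1) (nu2 nu2a nu2na : set X -> H2 -> H2)
    (povm1 : povm nu1) (povm2 : povm nu2) (ac12 : nu1 <<ac nu2)
    (dec1 : atomic_decomposition nu1 nu1a nu1na)
    (dec2 : atomic_decomposition nu2 nu2a nu2na) :
  (nu1a <<ac nu2a) /\ (nu1na <<ac nu2na).
Proof.
have [[p1a at1a] [p1na na1na] _] := dec1.
have [[p2a at2a] [p2na na2na] _] := dec2.
have transfer B : borel B -> nu2a B = 0 -> nu2na B = 0 ->
    nu1a B = 0 /\ nu1na B = 0.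
  move=> bB B2a B2na; apply/(atomic_decomposition_eq0 dec1 bB).
  by apply: ac12 => //; apply/(atomic_decomposition_eq0 dec2 bB).
split=> E bE E0; apply: contrapT => E1.
  have [A atomA AE] := at1a E bE E1.
  have [B [bB BA B1 B2na]] := atom_trim sep2 p1a p2na atomA na2na.
  have B2a := povm_null_sub p2a bB bE (subset_trans BA AE) E0.
  by apply: B1; case: (transfer B).
have [||D [bD DE D0] Dmax] := povm_exhaustion p2a (A0 := set0) sep2 _
    (bigcup_closed_null (E := E) p1na); first by move=> B [].
  by split; [exact: borel0|exact: sub0set|exact: povm_set0].
have bED := borelD bE bD.
have ED0 : nu2a (E `\` D) = 0.
  apply: contrapT => ED0; have [A atomA AED] := at2a _ bED ED0.
  have [B [bB BA B2a B1na]] := atom_trim sep1 p2a p1na atomA na1na.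
  apply: B2a; rewrite -(Dmax B).
    by congr nu2a; apply/esym/setDidl/disjoints_subset => x /BA/AED[].
  by split=> //; apply: (subset_trans BA) => x /AED[].
have ED2na : nu2na (E `\` D) = 0.
  by apply: (povm_null_sub p2na bED bE) E0; exact: subDsetl.
have [_ ED1na] := transfer _ bED ED0 ED2na.
by apply: E1; rewrite (povmD p1na bD bE DE) D0 ED1na addr0.
Qed.
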